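(* Let $M=B^3$ be the closed 3-ball, and consider the strict static case, $N=S^1\times B^3$. Then the Smale degree of the smooth proper Fredholm map of index $0$ $$\Pi:\mathcal E_+\to Met_+(\partial M)\times\mathcal C_+(\partial M)\times\mathbb R,\qquad \Pi(g,u)=(\gamma,[H],\mu),$$ satisfies $\deg_{\mathbb Z_2}\Pi=0$.
   Context: Fix $m\ge2$, $\alpha\in(0,1)$. A strictly static vacuum solution on $M$ is a pair $(g,u)$ with $g$ a Riemannian metric on $M$ and $u>0$ a function on $M$ (including $\partial M$), satisfying $u\,Ric_g=D^2u$, $\Delta_gu=0$ (equivalently $u^2d\theta^2+g$ is a Ricci-flat metric on $N=S^1\times M$). $\mathcal E=\mathcal E^{m,\alpha}(M)$ is the space of such pairs that are $C^{m,\alpha}$ up to $\partial M$, modulo $C^{m+1,\alpha}$ diffeomorphisms of $M$ equal to the identity on $\partial M$; it is a smooth Banach manifold. $\gamma$ is the induced metric on $\partial M$, $H$ the mean curvature of $\partial M$ (with respect to the outward normal, so $H=2$ for the unit sphere bounding the unit ball in $\mathbb R^3$). $Met_+(\partial M)$ is the space of $C^{m,\alpha}$ metrics on $\partial M$ with positive Gauss curvature; $\mathcal C_+(\partial M)$ is the space of positive $C^{m-1,\alpha}$ functions on $\partial M$ modulo multiplication by positive constants, $[H]$ denoting the class of $H$. $\mu=\int_{\partial M}(|d\nu|^4+\nu^2)\,dv_\gamma$, where $\nu=\log u$ and $d\nu$ is its differential on $\partial M$. $\mathcal E_+\subset\mathcal E$ is the set of solutions whose boundary metric has positive Gauss curvature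 and for which $H>0$. For a smooth proper Fredholm map $F:X\to Y$ of index $0$ between Banach manifolds, the Smale degree is $\deg_{\mathbb Z_2}F=\#F^{-1}(y)\pmod 2$, for any regular value $y\in Y$ of $F$. The map $\Pi$ above is such a map. *)

(* Defs.v *)
From HB Require Import structures.
From mathcomp Require Import all_boot all_order all_algebra.
From mathcomp Require Import all_classical all_reals all_analysis.
From mathcomp Require Import ring.
Set Implicit Arguments.
Unset Strict Implicit.
Unset Printing Implicit Defensive.
Import Order.TTheory GRing.Theory Num.Theory.
Import numFieldNormedType.Exports.
Local Open Scope classical_set_scope.
Local Open Scope ring_scope.

Section Calculus.
Context {R : realType} {n : nat}.
Local Notation E := 'rV[R]_n.+1.
Implicit Types (f : E -> R) (k : nat) (alpha : R).

Definition pd (i : 'I_n.+1) f : E -> R := fun x => 'D_(delta_mx 0 i) f x.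

Definition pds (s : seq 'I_n.+1) f : E -> R := foldr pd f s.

Definition Ck k f : Prop :=
  (forall s, (size s <= k)%N -> continuous (pds s f)) /\
  (forall s i, (size s < k)%N ->
     forall x, derivable (pds s f) x (delta_mx 0 i)).

Definition sqnorm (x : E) : R := \sum_i x 0 i ^+ 2.

Definition unit_ball : set E := [set x | sqnorm x <= 1].

(* The functions that are C^{k,alpha} on the closed ball, up to its boundary,
   are the restrictions to the ball of the functions f such that
   [Holder k alpha f].  All the objects living on the closed ball are
   represented by such extensions, so that derivatives at boundary points make
   sense; up to order k these derivatives only depend on the restriction of f to
   the ball.  [`|x - y|] is the sup norm, which is equivalent to the Euclidean
   one. *)
Definition Holder k alpha f : Prop :=
  Ck k f /\
  exists c : R, forall s, size s = k -> forall x y,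
    unit_ball x -> unit_ball y ->
    `|pds s f x - pds s f y| <= c * `|x - y| `^ alpha.

End Calculus.

(* Riemannian geometry in the standard coordinates of R^{n+1}; the metric is
   given by its matrix, g x i j = g_x(d_i, d_j). *)
Section Geometry.
Context {R : realType} {n : nat}.
Local Notation E := 'rV[R]_n.+1.
Implicit Types (g : E -> 'M[R]_n.+1) (u : E -> R).

(* Gamma^k_{ij} *)
Definition christoffel g (k i j : 'I_n.+1) (x : E) : R :=
  2^-1 * \sum_l invmx (g x) k l *
    (pd i (fun z => g z j l) x + pd j (fun z => g z i l) x
     - pd l (fun z => g z i j) x).

(* The coefficient R^l_{kij} in R(d_i, d_j) d_k = \sum_l R^l_{kij} d_l, where
   R(X, Y) = [nabla_X, nabla_Y] - nabla_[X, Y]. *)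
Definition riemann g (l k i j : 'I_n.+1) (x : E) : R :=
  pd i (christoffel g l j k) x - pd j (christoffel g l i k) x
  + \sum_p (christoffel g l i p x * christoffel g p j k x
            - christoffel g l j p x * christoffel g p i k x).

Definition ricci g (i j : 'I_n.+1) (x : E) : R := \sum_k riemann g k j k i x.

Definition hessian g u (i j : 'I_n.+1) (x : E) : R :=
  pd i (pd j u) x - \sum_k christoffel g k i j x * pd k u x.

Definition laplacian g u (x : E) : R :=
  \sum_i \sum_j invmx (g x) i j * hessian g u i j x.

Definition grad_sq g u (x : E) : R :=
  \sum_i \sum_j invmx (g x) i j * pd i u x * pd j u x.

Definition divergence g (X : E -> E) (x : E) : R :=
  \sum_i (pd i (fun z => X z 0 i) x
          + \sum_j christoffel g i i j x * X x 0 j).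

Definition symmetric_mx (A : 'M[R]_n.+1) : Prop := A^T = A.

Definition quad (A : 'M[R]_n.+1) (v : E) : R := (v *m A *m v^T) 0 0.

Definition posdef_mx (A : 'M[R]_n.+1) : Prop :=
  symmetric_mx A /\ forall v, v != 0 -> 0 < quad A v.

(* J i a = d_i psi^a *)
Definition jacobian_rows p (psi : E -> 'rV[R]_p) (x : E) : 'M[R]_(n.+1, p) :=
  \matrix_(i, a) pd i (fun z => psi z 0 a) x.

End Geometry.

Definition gauss_curvature {R : realType} (G : 'rV[R]_2 -> 'M[R]_2)
    (y : 'rV[R]_2) : R :=
  (\sum_l G y 0 l * riemann G l 1 0 1 y) / \det (G y).

Section Sphere.
Context {R : realType}.
Local Notation E3 := 'rV[R]_3.
Local Notation E2 := 'rV[R]_2.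

Definition sphere : Type := {x : E3 | sqnorm x == 1}.

(* C^{k,alpha} functions on the sphere: the restrictions of the C^{k,alpha}
   functions on the closed ball. *)
Definition sphere_Holder k (alpha : R) (f : sphere -> R) : Prop :=
  exists2 F : E3 -> R, Holder k alpha F & forall p, f p = F (sval p).

Definition tangent_proj (p : sphere) : 'M[R]_3 :=
  1%:M - (sval p)^T *m sval p.

(* A symmetric bilinear form on the tangent plane at p is represented by the
   symmetric matrix of its extension by 0 to the normal line, so that a field
   of such forms is determined by its values. *)
Definition tangential_form k (alpha : R) (h : sphere -> 'M[R]_3) : Prop :=
  (forall p, symmetric_mx (h p)) /\
  (forall p, tangent_proj p *m h p *m tangent_proj p = h p) /\
  (forall i j, sphere_Holder k alpha (fun p => h p i j)).

Definition sphere_metric k (alpha : R) (gam : sphere -> 'M[R]_3) : Prop :=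
  tangential_form k alpha gam /\
  forall p (v : E3), v *m (sval p)^T = 0 -> v != 0 -> 0 < quad (gam p) v.

(* Inverse stereographic projection from the north (s = false) or the south
   (s = true) pole. *)
Definition stereo_fun (s : bool) (y : E2) : E3 :=
  (1 + sqnorm y)^-1 *:
    \row_a tnth [tuple 2 * y 0 0; 2 * y 0 1; (-1) ^+ s * (sqnorm y - 1)] a.

Lemma stereo_subproof s y : sqnorm (stereo_fun s y) == 1.
Proof.
have h0 : 0 <= sqnorm y by apply: sumr_ge0 => i _; exact: sqr_ge0.
have h1 : 1 + sqnorm y != 0 by rewrite gt_eqF// ltr_pwDl.
have e : y 0 0 ^+ 2 + y 0 1 ^+ 2 = sqnorm y.
  rewrite /sqnorm !big_ord_recl big_ord0 addr0.
  by congr (_ ^+ 2 + y _ _ ^+ 2); apply: val_inj.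
apply/eqP; rewrite {1}/sqnorm !big_ord_recl big_ord0 !mxE !(tnth_nth 0) /=.
rewrite !exprMn sqrr_sign.
have -> : y 0 0 ^+ 2 = sqnorm y - y 0 1 ^+ 2 by rewrite -e addrK.
by field.
Qed.

Definition stereo (s : bool) (y : E2) : sphere :=
  exist _ (stereo_fun s y) (stereo_subproof s y).

Definition chart_metric (s : bool) (gam : sphere -> 'M[R]_3) (y : E2) :
    'M[R]_2 :=
  jacobian_rows (stereo_fun s) y *m gam (stereo s y)
    *m (jacobian_rows (stereo_fun s) y)^T.

Definition positive_gauss (gam : sphere -> 'M[R]_3) : Prop :=
  forall s y, 0 < gauss_curvature (chart_metric s gam) y.

(* The chart [stereo false] covers the sphere up to one point, which is
   negligible. *)
Definition sphere_integral (gam : sphere -> 'M[R]_3) (f : E2 -> R) : R :=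
  \int[(@lebesgue_measure R \x @lebesgue_measure R)%E]_z
    (let y : E2 := \row_i (if i == 0 then z.1 else z.2) in
     f y * Num.sqrt (\det (chart_metric false gam y))).

(* \int (|d nu|^4 + nu^2) dv_gam *)
Definition mu_functional (gam : sphere -> 'M[R]_3) (nu : sphere -> R) : R :=
  sphere_integral gam (fun y =>
    grad_sq (chart_metric false gam) (fun z => nu (stereo false z)) y ^+ 2
    + nu (stereo false y) ^+ 2).

End Sphere.
Arguments sphere R : clear implicits.

Section StaticVacuum.
Context {R : realType}.
Variables (m : nat) (alpha : R).
Local Notation E3 := 'rV[R]_3.

Definition static_pair : Type := ((E3 -> 'M[R]_3) * (E3 -> R))%type.

Definition static_ricci (q : static_pair) (i j : 'I_3) (x : E3) : R :=
  q.2 x * ricci q.1 i j x - hessian q.1 q.2 i j x.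

Definition static_laplace (q : static_pair) (x : E3) : R :=
  laplacian q.1 q.2 x.

Definition static_vacuum : set static_pair := [set q : static_pair |
  [/\ (forall i j, Holder m alpha (fun x => q.1 x i j)),
      Holder m alpha q.2,
      (forall x, unit_ball x -> posdef_mx (q.1 x)),
      (forall x, unit_ball x -> 0 < q.2 x) &
      (forall x, unit_ball x ->
         (forall i j, static_ricci q i j x = 0) /\ static_laplace q x = 0)]].

Definition boundary_diffeo (psi : E3 -> E3) : Prop :=
  [/\ (forall a, Holder m.+1 alpha (fun x => psi x 0 a)),
      (forall p : sphere R, psi (sval p) = sval p),
      (forall x, unit_ball x -> unit_ball (psi x)) &
      exists phi : E3 -> E3,
        [/\ (forall a, Holder m.+1 alpha (fun x => phi x 0 a)),
            (forall x, unit_ball x -> unit_ball (phi x)),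
            (forall x, unit_ball x -> phi (psi x) = x) &
            (forall x, unit_ball x -> psi (phi x) = x)]].

(* q is the pull-back of p by a diffeomorphism fixing the boundary.  For psi the
   identity on the ball, this identifies two extensions of the same pair. *)
Definition isometric (p q : static_pair) : Prop :=
  exists2 psi, boundary_diffeo psi & forall x, unit_ball x ->
    q.1 x = jacobian_rows psi x *m p.1 (psi x) *m (jacobian_rows psi x)^T
    /\ q.2 x = p.2 (psi x).

(* The point of the moduli space E represented by p. *)
Definition moduli_class (p : static_pair) : set static_pair :=
  static_vacuum `&` [set q : static_pair | isometric p q].

Definition boundary_metric (g : E3 -> 'M[R]_3) (p : sphere R) : 'M[R]_3 :=
  tangent_proj p *m g (sval p) *m tangent_proj p.

(* The unit normal to the level sets of sqnorm; it points outward on the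
   sphere. *)
Definition unit_normal (g : E3 -> 'M[R]_3) (x : E3) : E3 :=
  (Num.sqrt (quad (invmx (g x)) x))^-1 *: (x *m invmx (g x)).

(* tr_gam (nabla N) = div_g N, since N has unit length near the sphere. *)
Definition mean_curvature (g : E3 -> 'M[R]_3) (p : sphere R) : R :=
  divergence g (unit_normal g) (sval p).

Definition mu_of (q : static_pair) : R :=
  mu_functional (boundary_metric q.1) (fun p => ln (q.2 (sval p))).

Definition solutions_plus : set static_pair :=
  static_vacuum `&` [set q : static_pair |
  positive_gauss (boundary_metric q.1) /\
  forall p, 0 < mean_curvature q.1 p].

Definition scaling_class (f : sphere R -> R) : set (sphere R -> R) :=
  [set h | exists2 c : R, 0 < c & forall p, h p = c * f p].

Definition Met_plus : set (sphere R -> 'M[R]_3) :=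
  [set gam | sphere_metric m alpha gam /\ positive_gauss gam].

Definition C_plus : set (set (sphere R -> R)) :=
  [set scaling_class f | f in [set f |
     sphere_Holder m.-1 alpha f /\ forall p, 0 < f p]].

Definition boundary_data : Type :=
  ((sphere R -> 'M[R]_3) * set (sphere R -> R) * R)%type.

Definition target : set boundary_data := Met_plus `*` C_plus `*` [set: R].

Definition Pi (q : static_pair) : boundary_data :=
  (boundary_metric q.1, scaling_class (mean_curvature q.1), mu_of q).

Definition deform (q w : static_pair) (t : R) : static_pair :=
  ((fun x => q.1 x + t *: w.1 x), (fun x => q.2 x + t * w.2 x)).

(* Solutions of the static vacuum equations linearized at q.  The tangent space
   of E at the class of q is the quotient of this space by the infinitesimal
   diffeomorphisms vanishing on the boundary, on which the differential of Pi
   vanishes. *)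
Definition infinitesimal_static (q : static_pair) : set static_pair :=
  [set w : static_pair |
  [/\ (forall i j, Holder m alpha (fun x => w.1 x i j)),
      Holder m alpha w.2,
      (forall x, unit_ball x -> symmetric_mx (w.1 x)) &
      (forall x, unit_ball x ->
         (forall i j,
            derive1 (fun t => static_ricci (deform q w t) i j x) 0 = 0)
         /\ derive1 (fun t => static_laplace (deform q w t) x) 0 = 0)]].

(* The tangent space of the space of positive functions modulo scaling at [H] is
   the quotient of the C^{m-1,alpha} functions by the line spanned by H. *)
Definition differential_surjective (q : static_pair) : Prop :=
  forall (k : sphere R -> 'M[R]_3) (f : sphere R -> R) (r : R),
    tangential_form m alpha k -> sphere_Holder m.-1 alpha f ->
    exists2 w, infinitesimal_static q w &
      [/\ boundary_metric w.1 = k,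
          (exists c : R, forall p,
             derive1 (fun t => mean_curvature (deform q w t).1 p) 0
             = f p + c * mean_curvature q.1 p) &
          derive1 (fun t => mu_of (deform q w t)) 0 = r].

(* The set of the points of E_+ that Pi sends to y. *)
Definition fiber (y : boundary_data) : set (set static_pair) :=
  [set moduli_class q | q in
    solutions_plus `&` [set q : static_pair | Pi q = y]].

Definition regular_value (y : boundary_data) : Prop :=
  target y /\
  forall q, solutions_plus q -> Pi q = y -> differential_surjective q.

(* d is the Smale degree of Pi : E_+ -> Met_+ x C_+ x R, i.e. the parity of the
   fiber over any regular value. *)
Definition is_smale_degree (d : 'F_2) : Prop :=
  (exists y, regular_value y) /\
  forall y, regular_value y ->
    exists2 N : nat, (fiber y #= `I_N)%card & N%:R = d.

End StaticVacuum.
Arguments static_pair R : clear implicits.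

(* Main.v *)
Require Import Defs.
From mathcomp Require Import all_boot all_order all_algebra.
From mathcomp Require Import all_classical all_reals all_analysis.
Import Order.TTheory GRing.Theory Num.Theory.
Local Open Scope ring_scope.

(** The degree can be read off from any regular value, and a value that is not
    attained is vacuously regular, with an empty fiber.  Such values exist
    because the third component mu of Pi is the integral of a nonnegative
    function ([mu_functional_ge0]), while the third factor of the target is the
    whole real line: replacing the last coordinate of any point of the target
    by -1 gives a point that Pi misses ([fiber_neg_mu]).  Hence Pi is not
    surjective and its degree is 0. *)

(** Pointwise, the integrand is a sum of even powers times a square root, so its
    integral is nonnegative; [mu_functional] takes the value 0 when this integral
    is infinite. *)
Lemma mu_functional_ge0 (R : realType) (gam : sphere R -> 'M[R]_3)
    (nu : sphere R -> R) : 0 <= mu_functional gam nu.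
Proof.
apply: Rintegral_ge0 => z _ /=.
by rewrite mulr_ge0 ?sqrtr_ge0 // addr_ge0 ?sqr_ge0.
Qed.

Lemma Pi_neq_neg_mu (R : realType) (gam : sphere R -> 'M[R]_3)
    (C : set (sphere R -> R)) (r : R) (q : static_pair R) :
  r < 0 -> Pi q <> (gam, C, r).
Proof.
by move=> r_lt0 [_ _ mu_r]; move: r_lt0; rewrite -mu_r ltNge mu_functional_ge0.
Qed.

Lemma fiber_neg_mu (R : realType) (m : nat) (alpha : R)
    (gam : sphere R -> 'M[R]_3) (C : set (sphere R -> R)) (r : R) :
  r < 0 -> fiber m alpha (gam, C, r) = set0.
Proof.
move=> r_lt0; rewrite -subset0 => A [q [_ Piq] _].
exact: Pi_neq_neg_mu Piq.
Qed.

Lemma regular_value_neg_mu (R : realType) (m : nat) (alpha : R)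
    (gam : sphere R -> 'M[R]_3) (C : set (sphere R -> R)) (r : R) :
  Met_plus m alpha gam -> C_plus m alpha C -> r < 0 ->
  regular_value m alpha (gam, C, r).
Proof.
move=> gamP CP r_lt0; split; first by [].
by move=> q _ /Pi_neq_neg_mu.
Qed.

Theorem theorem1p2 (R : realType) (m : nat) (alpha : R)
    (hm : (2 <= m)%N) (halpha0 : 0 < alpha) (halpha1 : alpha < 1)
    (hdeg : exists d : 'F_2, is_smale_degree m alpha d) :
  is_smale_degree m alpha 0.
Proof.
have [d degd] := hdeg.
(* The regular value that comes with the degree d is used only to get a point
   (gam, C) of Met_+ x C_+, without constructing a metric by hand. *)
have [[[[gam C] r] [[[gamP CP] _] _]] parity] := degd.
have [N] := parity _ (regular_value_neg_mu _ _ _ _ _ _ gamP CP (ltrN10 R)).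
(* [card_eq0] compares across types, so the empty fiber can be exchanged for the
   empty set of naturals. *)
rewrite fiber_neg_mu ?ltrN10 // card_eq_sym card_eq0 -(@card_eq0 _ nat) -II0.
by move=> /card_eq_II -> d0; rewrite [0]d0.
Qed.
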